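(* Let $G$ be a compact, connected Lie group and let $(M,\omega)$ be a compact, connected, quantizable Hamiltonian $G$-space with moment map $\Phi:M\to\mathfrak{g}^*$. Let $\{g_t\}_{t\in[0,1]}$ be a curve in $G$ with $g_0=e$ and let $\varphi_t(x)=g_t\cdot x$. If $x_0\in M$ is a fixed point for the $G$-action and if the isotopy $\varphi=\{\varphi_t\}$ is closed (i.e. $\varphi_1=\mathrm{id}$), then $$\kappa(\varphi)=\exp\Big(-2\pi i\Big\langle\Phi(x_0),\int_0^1A_t\,dt\Big\rangle\Big),\qquad A_t=\dot g_tg_t^{-1}.$$
   Context: Quantizable means $[\omega]$ is an integral cohomology class. $G$ acts on the left by symplectomorphisms; for $A\in\mathfrak{g}$, $X_A$ is the vector field on $M$ generated by $A$, and $f_A(x)=\langle\Phi(x),A\rangle$. The moment map conventions are $\iota_{X_A}\omega=-df_A$ and $\{f_A,f_B\}:=\omega(X_B,X_A)=f_{[A,B]}$. The isotopy $\varphi_t(x)=g_t\cdot x$ is generated by the vector fields $X_{A_t}$, $A_t=\dot g_tg_t^{-1}$, and its time-dependent Hamiltonian is taken to be $f_{A_t}=\langle\Phi,A_t\rangle$. The action integral is $$\kappa(\varphi)=\exp\Big(2\pi i\int_S\omega-2\pi i\int_0^1 f_{A_t}(\varphi_t(x))\,dt\Big),$$ where $S$ is any $2$-chain with boundary the (nullhomologous) closed curve $\{\varphi_t(x)\}_t$; it is independent of $S$ and of $x\in M$. *)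

(* Defs.v *)
From HB Require Import structures.
From mathcomp Require Import all_boot all_order all_algebra.
From mathcomp Require Import all_classical all_reals all_analysis.
From mathcomp Require Import complex.

Set Implicit Arguments.
Unset Strict Implicit.
Unset Printing Implicit Defensive.

Import Order.TTheory GRing.Theory Num.Theory.
Import numFieldNormedType.Exports.

Local Open Scope classical_set_scope.
Local Open Scope ring_scope.

(* Only meaningful for U open; V is finite dimensional in all uses, so this
   agrees with continuity of all partial derivatives up to order k. *)
Fixpoint Ck (R : realType) (V W : normedModType R) (k : nat) (U : set V)
    (f : V -> W) : Prop :=
  match k with
  | 0 => forall x, U x -> {for x, continuous f}
  | k'.+1 => (forall x, U x -> differentiable f x) /\
             (forall v : V, Ck k' U (fun x => 'D_v f x))
  end.

Definition Cinfty (R : realType) (V W : normedModType R) (U : set V)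
  (f : V -> W) : Prop := forall k, Ck k U f.

(* [chart_inv] is meaningful on the image of the chart only. *)
Record chart (R : realType) (n : nat) (T : topologicalType) := Chart {
  chart_dom : set T;
  chart_fwd : T -> 'rV[R]_n;
  chart_inv : 'rV[R]_n -> T;
  chart_dom_open : open chart_dom;
  chart_img_open : open (chart_fwd @` chart_dom);
  chart_fwdK : forall x, chart_dom x -> chart_inv (chart_fwd x) = x;
  chart_fwd_cont : forall x, chart_dom x -> {for x, continuous chart_fwd};
  chart_inv_cont : forall u, (chart_fwd @` chart_dom) u ->
    {for u, continuous chart_inv} }.

Definition chart_img (R : realType) (n : nat) (T : topologicalType)
  (c : chart R n T) : set 'rV[R]_n := chart_fwd c @` chart_dom c.

(* The atlas is the family [chart_at x], where [chart_at x] is a chart around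
   x.  This fixes a trivialisation of every tangent space: the row vector v
   stands for the tangent vector \sum_i v_i d/dx_i at x in the coordinates
   [chart_at x]. *)
HB.mixin Record Topological_isManifold (R : realType) (n : nat) T
    of Topological T := {
  chart_at : T -> chart R n T;
  chart_at_dom : forall x, chart_dom (chart_at x) x;
  chart_at_compat : forall x y,
    Cinfty (chart_fwd (chart_at x) @`
              (chart_dom (chart_at x) `&` chart_dom (chart_at y)))
           (fun u => chart_fwd (chart_at y) (chart_inv (chart_at x) u));
  manifold_hausdorff : hausdorff_space T;
  manifold_second_countable : @second_countable T }.

#[short(type="manifoldType")]
HB.structure Definition Manifold (R : realType) (n : nat) :=
  {T of Topological T & Topological_isManifold R n T}.

Section Maps.
Variables (R : realType).

Definition mcoord n (M : manifoldType R n) (x : M) : M -> 'rV[R]_n :=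
  chart_fwd (@chart_at R n M x).
Definition muncoord n (M : manifoldType R n) (x : M) : 'rV[R]_n -> M :=
  chart_inv (@chart_at R n M x).
Definition cdom n (M : manifoldType R n) (x : M) : set M :=
  chart_dom (@chart_at R n M x).
Definition cimg n (M : manifoldType R n) (x : M) : set 'rV[R]_n :=
  chart_img (@chart_at R n M x).

Definition smooth_from (V : normedModType R) n (M : manifoldType R n)
    (U : set V) (s : V -> M) : Prop :=
  (forall u, U u -> {for u, continuous s}) /\
  (forall y : M, Cinfty (U `&` s @^-1` cdom y) (fun u => mcoord y (s u))).

Definition smooth_map m n (N : manifoldType R m) (M : manifoldType R n)
    (F : N -> M) : Prop :=
  forall x : N, smooth_from (cimg x) (fun u => F (muncoord x u)).

Definition smooth_map2 l m n (N : manifoldType R l) (P : manifoldType R m)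
    (M : manifoldType R n) (F : N -> P -> M) : Prop :=
  forall (x : N) (y : P), smooth_from (cimg x `*` cimg y)
    (fun u : 'rV[R]_l * 'rV[R]_m => F (muncoord x u.1) (muncoord y u.2)).

Definition smooth_fun n (M : manifoldType R n) (f : M -> R) : Prop :=
  forall x : M, Cinfty (cimg x) (fun u => f (muncoord x u)).

Definition smooth_curve n (M : manifoldType R n) (g : R -> M) : Prop :=
  exists U : set R, [/\ open U, `[0, 1] `<=` U & smooth_from U g].

(* The differentials below are expressed in the preferred coordinates at the
   source and target points. *)
Definition tangent_map m n (N : manifoldType R m) (M : manifoldType R n)
    (F : N -> M) (x : N) (v : 'rV[R]_m) : 'rV[R]_n :=
  'D_v (fun u => mcoord (F x) (F (muncoord x u))) (mcoord x x).

Definition dfun n (M : manifoldType R n) (f : M -> R) (x : M) (v : 'rV[R]_n) :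
    R := 'D_v (fun u => f (muncoord x u)) (mcoord x x).

Definition velocity n (M : manifoldType R n) (g : R -> M) (t : R) :
    'rV[R]_n := derive1 (fun s => mcoord (g t) (g s)) t.

End Maps.

HB.mixin Record isLieGroup (R : realType) (n : nat) G
    of Manifold R n G & Group G := {
  lie_mul_smooth : @smooth_map2 R n n n G G G (fun g h : G => (g * h)%g);
  lie_inv_smooth : @smooth_map R n n G G (fun g : G => (g^-1)%g) }.

#[short(type="lieGroupType")]
HB.structure Definition LieGroup (R : realType) (n : nat) :=
  {G of Manifold R n G & Group G & isLieGroup R n G}.

Section LieAlgebra.
Variables (R : realType) (m : nat) (G : lieGroupType R m).

(* The Lie algebra T_e G is 'rV[R]_m, in the coordinates of [chart_at 1]. *)
Definition left_inv_field (A : 'rV[R]_m) (u : 'rV[R]_m) : 'rV[R]_m :=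
  'D_A (fun v => mcoord (1%g : G)
                   (muncoord (1%g : G) u * muncoord (1%g : G) v)%g)
       (mcoord (1%g : G) 1%g).

(* The value at e of the commutator of left-invariant vector fields. *)
Definition lie_bracket (A B : 'rV[R]_m) : 'rV[R]_m :=
  'D_A (left_inv_field B) (mcoord (1%g : G) 1%g)
  - 'D_B (left_inv_field A) (mcoord (1%g : G) 1%g).

(* \dot g_t g_t^{-1} *)
Definition right_log_deriv (g : R -> G) (t : R) : 'rV[R]_m :=
  tangent_map (fun h : G => (h * (g t)^-1)%g) (g t) (velocity g t).

End LieAlgebra.

Section Forms.
Variables (R : realType) (n : nat) (M : manifoldType R n).

Definition two_tensor := M -> 'rV[R]_n -> 'rV[R]_n -> R.

(* The component of w along the constant fields v1, v2 of the chart at x,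
   whose values at y = muncoord x u are moved to the coordinates at y. *)
Definition local_form (w : two_tensor) (x : M) (v1 v2 u : 'rV[R]_n) : R :=
  let y := muncoord x u in
  let d v := 'D_v (fun u' => mcoord y (muncoord x u')) u in
  w y (d v1) (d v2).

Record is_symplectic (w : two_tensor) : Prop := IsSymplectic {
  symp_linear : forall x a v1 v2 v3,
    w x (a *: v1 + v2) v3 = a * w x v1 v3 + w x v2 v3;
  symp_alternating : forall x v, w x v v = 0;
  symp_nondegenerate : forall x v, (forall v', w x v v' = 0) -> v = 0;
  symp_smooth : forall x v1 v2, Cinfty (cimg x) (local_form w x v1 v2);
  symp_closed : forall x v1 v2 v3 u, cimg x u ->
    'D_v1 (local_form w x v2 v3) u + 'D_v2 (local_form w x v3 v1) u
    + 'D_v3 (local_form w x v1 v2) u = 0 }.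

End Forms.

Section Chains.
Variables (R : realType) (n : nat) (M : manifoldType R n).

Definition std_simplex k : set 'rV[R]_k.+1 :=
  [set p | (forall j, 0 <= p 0 j) /\ \sum_j p 0 j = 1].

(* A singular simplex is the restriction of such a map to [std_simplex k]; it
   is smooth when it extends smoothly to a neighbourhood. *)
Definition simplex (k : nat) := 'rV[R]_k.+1 -> M.

Definition simplex_eq k (s t : simplex k) : Prop :=
  forall p, std_simplex p -> s p = t p.

Definition smooth_simplex k (s : simplex k) : Prop :=
  exists U : set 'rV[R]_k.+1,
    [/\ open U, @std_simplex k `<=` U & smooth_from U s].

Definition face k (i : 'I_k.+2) (s : simplex k.+1) : simplex k :=
  fun p => s (\row_j (if unlift i j is Some l then p 0 l else 0)).

(* Formal integer combinations, equal when all coefficients agree. *)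
Definition chain (k : nat) := seq (int * simplex k).

Definition coef k (c : chain k) (t : simplex k) : int :=
  \sum_(p <- c) (if `[< simplex_eq p.2 t >] then p.1 else 0).

Definition chain_eq k (c d : chain k) : Prop :=
  forall t, coef c t = coef d t.

Fixpoint smooth_chain k (c : chain k) : Prop :=
  if c is p :: c' then smooth_simplex p.2 /\ smooth_chain c' else True.

Definition boundary k (c : chain k.+1) : chain k :=
  flatten [seq [seq ((-1) ^+ i * p.1, face i p.2) | i : 'I_k.+2] | p <- c].

Definition is_cochain k (T : Type) (b : simplex k -> T) : Prop :=
  forall s t, simplex_eq s t -> b s = b t.

Definition eval_cochain k (A : pzRingType) (b : simplex k -> A)
  (c : chain k) : A := \sum_(p <- c) p.1%:~R * b p.2.

Definition bary2 (a b : R) : 'rV[R]_3 :=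
  \row_j nth 0 [:: 1 - a - b; a; b] j.

Definition int_simplex (w : two_tensor M) (s : simplex 2) : R :=
  (\int[lebesgue_measure]_(a in `[0%R, 1%R])
    \int[lebesgue_measure]_(b in `[0%R, (1 - a)%R])
      w (s (bary2 a b)) (velocity (fun a' => s (bary2 a' b)) a)
                        (velocity (fun b' => s (bary2 a b')) b))%R.

Definition int_chain (w : two_tensor M) (S : chain 2) : R :=
  eval_cochain (int_simplex w) S.

(* The de Rham class of w, as a real smooth singular cocycle, is the image of
   an integral class: it differs by a coboundary from an integral cocycle. *)
Definition quantizable (w : two_tensor M) : Prop :=
  exists (c : simplex 2 -> int) (b : simplex 1 -> R),
    [/\ is_cochain c, is_cochain b,
        (forall s : simplex 3, smooth_simplex s ->
           eval_cochain c (boundary [:: (1, s)]) = 0)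
      & (forall s : simplex 2, smooth_simplex s ->
           int_simplex w s =
           (c s)%:~R + eval_cochain b (boundary [:: (1, s)]))].

Definition curve_simplex (g : R -> M) : simplex 1 := fun p => g (p 0 1).

Definition bounds_curve (S : chain 2) (g : R -> M) : Prop :=
  smooth_chain S /\ chain_eq (boundary S) [:: (1, curve_simplex g)].

Local Open Scope complex_scope.

Definition expC (z : R[i]) : R[i] :=
  (expR (complex.Re z) * cos (complex.Im z))
  +i* (expR (complex.Re z) * sin (complex.Im z)).

(* All base points x and all 2-chains S are allowed.  For a closed Hamiltonian
   isotopy phi with time-dependent Hamiltonian f on a quantizable space they all
   give the same number; [kappa] is the value at some unspecified choice. *)
Definition action_values (w : two_tensor M) (phi : R -> M -> M)
    (f : R -> M -> R) : set R[i] :=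
  [set k | exists (x : M) (S : chain 2),
     bounds_curve S (fun t => phi t x) /\
     k = expC (0 +i* (2 * pi * int_chain w S
            - 2 * pi * \int[lebesgue_measure]_(t in `[0%R, 1%R])
                         f t (phi t x))%R)].

Definition kappa (w : two_tensor M) (phi : R -> M -> M) (f : R -> M -> R) :
  R[i] := xget 0 (action_values w phi f).

End Chains.

Section HamiltonianSpaces.
Variables (R : realType) (m n : nat).
Variables (G : lieGroupType R m) (M : manifoldType R n).

Definition gen_field (act : G -> M -> M) (A : 'rV[R]_m) (x : M) : 'rV[R]_n :=
  tangent_map (fun g : G => act g x) 1%g A.

Record is_hamiltonian_space (w : two_tensor M) (act : G -> M -> M)
    (Phi : M -> {scalar 'rV[R]_m}) : Prop := IsHamiltonianSpace {
  ham_symplectic : is_symplectic w;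
  ham_act1 : forall x, act 1%g x = x;
  ham_actM : forall g h x, act (g * h)%g x = act g (act h x);
  ham_act_smooth : smooth_map2 act;
  ham_act_symp : forall g x v1 v2,
    w (act g x) (tangent_map (act g) x v1) (tangent_map (act g) x v2)
    = w x v1 v2;
  ham_moment_smooth : forall A, smooth_fun (fun x => Phi x A);
  ham_moment : forall A x v,
    w x (gen_field act A x) v = - dfun (fun y => Phi y A) x v;
  ham_equivariant : forall A B x,
    w x (gen_field act B x) (gen_field act A x) = Phi x (lie_bracket G A B) }.

End HamiltonianSpaces.

Definition int_vec (R : realType) (m : nat) (A : R -> 'rV[R]_m) : 'rV[R]_m :=
  \row_i (\int[lebesgue_measure]_(t in `[0%R, 1%R]) A t 0 i)%R.

(* Main.v *)
Require Import Defs.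
From HB Require Import structures.
From mathcomp Require Import all_boot all_order all_algebra.
From mathcomp Require Import all_classical all_reals all_analysis.
From mathcomp Require Import complex.
From mathcomp Require Import lra.
Import Order.TTheory GRing.Theory Num.Theory.
Import numFieldNormedType.Exports.
Local Open Scope classical_set_scope.
Local Open Scope ring_scope.
Local Open Scope complex_scope.

Set Implicit Arguments.
Unset Strict Implicit.
Unset Printing Implicit Defensive.

(** The action integral is the same at every base point and for every spanning chain,
    so it may be computed at the fixed point x0. There the orbit is constant, it is
    spanned by a constant triangle of zero area, and what remains of the exponent is
    the integral of <Phi x0, A_t>, which is the pairing of Phi x0 with the integral of
    A_t.

    Independence of the spanning chain comes from quantizability. Write the period
    cochain of w on smooth triangles as an integral cochain plus the coboundary of a
    real cochain b. Then the area of a chain S is, modulo integers, the value of b on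
    the boundary of S ([int_chain_boundary]), so the exponent divided by 2 pi i is
    congruent to [reduced_action] x, the value of b on the orbit of x minus the integral
    of the Hamiltonian along it ([int_chain_reduced_action]).

    Independence of the base point is the flux argument. A smooth path p sweeps under
    the isotopy the cylinder (s, t) |-> g t (p s). Its velocity in t is the field
    generated by A_t ([gen_field_velocity]), so the moment map equation identifies w on
    the two velocities with the s-derivative of the Hamiltonian at time t
    ([omega_flow_velocity]), and integrating gives the area of the cylinder as a
    difference of Hamiltonian integrals ([int_triangles]). As the isotopy is closed,
    the sides t = 0 and t = 1 of the cylinder agree and drop out of its boundary,
    so the same area is, modulo integers, the difference of the values of b on the two
    orbits ([reduced_action_path]). Hence [reduced_action] is locally constant modulo
    integers, and constant because M is connected ([reduced_action_constant]).

    The use of smooth singular chains forces the cylinder to be smooth to all orders in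
    charts, which rests on the stability of [Ck] under composition ([Ck_comp]). *)

(** * Calculus of k-times differentiable maps *)

Section CkCalculus.
Context {R : realType}.
Implicit Types U V W : normedModType R.

(** Differentiability is a germ property: the difference of the two maps vanishes
    near x, hence is a little-o of anything there. *)
Lemma near_eq_differentiable {V W} (f g : V -> W) (x : V) :
  (\near x, f x = g x) -> differentiable f x -> differentiable g x.
Proof.
move=> fg df; rewrite -(subrK f g).
apply: differentiableD => //.
have fgx : g x = f x by rewrite (nbhs_singleton fg).
have ho : ((g - f) : V -> W) \o shift x = cst ((g - f) x) + (\0 : V -> W) +o_ 0 id.
  apply/eqaddoP => _ /posnumP[e]; near=> y.
  rewrite /= !fctE fgx subrr add0r subr0.
  rewrite (_ : f (y + x) = g (y + x)) ?subrr ?normr0 ?mulr_ge0 //.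
  by near: y; move/nbhs0P : fg; apply: filterS => y; rewrite addrC.
apply/diff_locallyP.
have d0 : 'd (g - f) x = (\0 : V -> W) :> (V -> W).
  by apply: diff_unique => //; exact: cst_continuous.
by rewrite d0; split => //; exact: cst_continuous.
Unshelve. all: by end_near. Qed.

(** [Ck k U f] only quantifies over single points of U, so it can be glued from
    arbitrary pieces, open or not. *)
Lemma Ck_local {V W} k (U : set V) (f : V -> W) :
  (forall x, U x -> exists2 U' : set V, U' x & Ck k U' f) -> Ck k U f.
Proof.
elim: k f => [|k IH] f H /=; first by move=> x /H[U' U'x fc]; exact: fc.
split; first by move=> x /H[U' U'x [df _]]; exact: df.
by move=> v; apply: IH => x /H[U' U'x [_ Df]]; exists U' => //; exact: Df.
Qed.

Lemma Ck_subset {V W} k (U U' : set V) (f : V -> W) :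
  U' `<=` U -> Ck k U f -> Ck k U' f.
Proof. by move=> UU' ?; apply: Ck_local => x /UU' Ux; exists U. Qed.

(** Openness of U is essential: f and g must have the same germs on U for their
    derivatives to agree there. *)
Lemma Ck_eq {V W} k (U : set V) (f g : V -> W) : open U ->
  (forall x, U x -> f x = g x) -> Ck k U f -> Ck k U g.
Proof.
move=> oU; elim: k f g => [|k IH] f g fg /=.
  move=> fc x Ux; have := fc x Ux; rewrite /prop_for /continuous_at -fg// => h.
  apply: cvg_trans h; apply: near_eq_cvg.
  by near do rewrite fg //; exact: open_nbhs_nbhs.
have nfg x : U x -> \near x, f x = g x.
  by move=> Ux; near do apply: fg; exact: open_nbhs_nbhs.
case=> df Df; split=> [x Ux|v].
  exact: near_eq_differentiable (nfg x Ux) (df x Ux).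
apply: (IH (fun x => 'D_v f x)) (Df v) => x Ux.
exact: near_eq_derive (nfg x Ux).
Unshelve. all: by end_near. Qed.

Lemma Ck_pred {V W} k (U : set V) (f : V -> W) : Ck k.+1 U f -> Ck k U f.
Proof.
elim: k f => [|k IH] f [df Df]; first by move=> x /df/differentiable_continuous.
by split=> // v; apply: (IH (fun x => 'D_v f x)); exact: Df.
Qed.

Lemma Ck_cst {V W} k (U : set V) (c : W) : Ck k U (fun=> c).
Proof.
elim: k c => [|k IH] c /=; first by move=> x _; exact: cst_continuous.
split=> [x _|v]; first exact: differentiable_cst.
by under eq_fun do rewrite derive_cst; exact: IH.
Qed.

Lemma Ck_linear {V W} k (U : set V) (f : {linear V -> W}) :
  continuous f -> Ck k U f.
Proof.
move=> fc; case: k => [|k] /=; first by move=> x _; exact: fc.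
split=> [x _|v]; first exact: linear_differentiable.
have Df x : 'D_v f x = f v.
  by rewrite deriveE ?diff_lin //; exact: linear_differentiable.
by under eq_fun do rewrite Df; exact: Ck_cst.
Qed.

Lemma CkD {V W} k (U : set V) (f g : V -> W) : open U ->
  Ck k U f -> Ck k U g -> Ck k U (fun x => f x + g x).
Proof.
move=> oU; elim: k f g => [|k IH] f g /=.
  by move=> fc gc x Ux; apply: continuousD; [exact: fc|exact: gc].
move=> [df Df] [dg Dg]; split=> [x Ux|v].
  by apply: differentiableD; [exact: df|exact: dg].
apply: (Ck_eq (f := fun x => 'D_v f x + 'D_v g x)) => //; last exact: IH.
by move=> x Ux; rewrite -deriveD //; apply: diff_derivable; [exact: df|exact: dg].
Qed.

Lemma Ck_sum {V W} {I : Type} (r : seq I) k (U : set V) (f : I -> V -> W) :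
  open U -> (forall i, Ck k U (f i)) -> Ck k U (fun x => \sum_(i <- r) f i x).
Proof.
move=> oU Hf; elim: r => [|i r IH].
  by under eq_fun do rewrite big_nil; exact: Ck_cst.
by under eq_fun do rewrite big_cons; exact: CkD.
Qed.

Lemma scale_is_bilinear {W} :
  bilinear_for
    (GRing.Scale.Law.clone _ _ *:%R _) (GRing.Scale.Law.clone _ _ *:%R _)
    (@GRing.scale R W : R^o -> W -> W).
Proof.
split=> [u'|u] a x y /=; first by rewrite scalerDl scalerA.
by rewrite scalerDr !scalerA mulrC.
Qed.

(** The Leibniz rule for a vector-valued factor, read off the differential of the
    continuous bilinear map of scaling. *)
Lemma is_diff_scale {V W} (a : V -> R) (f : V -> W) x :
  differentiable a x -> differentiable f x ->
  is_diff x (fun y => a y *: f y) (fun v => a x *: 'd f x v + 'd a x v *: f x).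
Proof.
move=> da df.
pose bM := bilinear_isBilinear.Build R R^o W W _ _ (@GRing.scale R W : R^o -> W -> W)
  scale_is_bilinear.
pose b : {bilinear R^o -> W -> W} := HB.pack (@GRing.scale R W : R^o -> W -> W) bM.
have bc : continuous (fun p : R^o * W => b p.1 p.2).
  by move=> p; exact: scale_continuous.
have dp := differentiable_pair da df.
have dbp := @differentiable_bilin R R^o W W b (a x, f x) bc.
apply: DiffDef; first exact: (differentiable_comp dp dbp).
rewrite (_ : (fun y => a y *: f y) = (fun p : R^o * W => b p.1 p.2) \o (fun y => (a y, f y))) //.
rewrite diff_comp //.
rewrite (@diff_bilin R R^o W W b) //.
by rewrite (@diff_pair R V R^o W).
Qed.

Lemma CkZ {V W} k (U : set V) (a : V -> R) (f : V -> W) : open U ->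
  Ck k U a -> Ck k U f -> Ck k U (fun x => a x *: f x).
Proof.
move=> oU; elim: k a f => [|k IH] a f.
  by move=> ac fc x Ux; apply: continuousZ; [exact: ac|exact: fc].
move=> ca cf; have [da Da] := ca; have [df Df] := cf.
have H x : U x -> is_diff x (fun y => a y *: f y)
    (fun v => a x *: 'd f x v + 'd a x v *: f x).
  by move=> Ux; apply: is_diff_scale; [exact: da|exact: df].
split=> [x /H //|v].
apply: (Ck_eq (f := fun x => a x *: 'D_v f x + 'D_v a x *: f x)) => //.
  move=> x Ux; have [d1 d2] := H x Ux.
  rewrite [RHS]deriveE // d2 !deriveE //; [exact: da|exact: df].
apply: CkD => //; apply: IH => //; [exact: Ck_pred|exact: Df|exact: Da|].
exact: Ck_pred.
Qed.

Lemma Ck_pair {V W W' : normedModType R} k (U : set V) (f : V -> W) (g : V -> W') :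
  open U -> Ck k U f -> Ck k U g -> Ck k U (fun x => (f x, g x)).
Proof.
move=> oU; elim: k f g => [|k IH] f g /=.
  by move=> fc gc x Ux; apply: cvg_pair; [exact: fc|exact: gc].
move=> [df Df] [dg Dg]; split=> [x Ux|v].
  by apply: differentiable_pair; [exact: df|exact: dg].
apply: (Ck_eq (f := fun x => ('D_v f x, 'D_v g x))) => //; last exact: IH.
move=> x Ux; have dfx := df x Ux; have dgx := dg x Ux.
rewrite [RHS]deriveE; last exact: differentiable_pair.
by rewrite diff_pair // !deriveE.
Qed.

(** Finite dimensionality in the form that the chain rule uses: every vector is
    expanded along finitely many fixed ones, with continuous linear coefficients. *)
Definition finite_frame (V : normedModType R) : Prop :=
  exists (I : finType) (e : I -> V) (l : I -> {linear V -> R^o}),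
    (forall i, continuous (l i)) /\ forall v, v = \sum_i l i v *: e i.

Lemma derive_comp {V W W' : normedModType R} (f : V -> W) (g : W -> W') x v :
  differentiable f x -> differentiable g (f x) ->
  'D_v (g \o f) x = 'D_('D_v f x) g (f x).
Proof.
move=> df dg; rewrite deriveE; last exact: differentiable_comp.
by rewrite diff_comp // deriveE // deriveE.
Qed.

Lemma Ck_linear_comp {V W W' : normedModType R} k (U : set V) (l : {linear W -> W'})
    (h : V -> W) : open U -> continuous l -> Ck k U h -> Ck k U (fun x => l (h x)).
Proof.
move=> oU lc; elim: k h => [|k IH] h.
  by move=> hc x Ux; apply: continuous_comp; [exact: hc|exact: lc].
move=> [dh Dh]; have dl y : differentiable l y := linear_differentiable y lc.
split=> [x Ux|v]; first by apply: differentiable_comp; [exact: dh|exact: dl].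
apply: (Ck_eq (f := fun x => l ('D_v h x))) => //.
  move=> x Ux; rewrite (derive_comp (g := l)) //; last exact: dh.
  by rewrite [RHS]deriveE // diff_lin.
by apply: (IH (fun x => 'D_v h x)); exact: Dh.
Qed.

Lemma derive_linear_sum {V W : normedModType R} {I : finType} (f : V -> W) x
    (c : I -> R) (e : I -> V) : differentiable f x ->
  'D_(\sum_i c i *: e i) f x = \sum_i c i *: 'D_(e i) f x.
Proof.
move=> df; rewrite deriveE // linear_sum; apply: eq_bigr => i _.
by rewrite linearZ deriveE.
Qed.

(** The derivative of g \o f along v is the derivative of g along a direction that
    moves with the point. Expanding this direction in a frame (e, l) of W gives the
    sum over i of l i ('D_v f x) *: 'D_(e i) g (f x), whose factors are one order
    less differentiable than f and g; so the product rule closes an induction on k. *)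
Lemma Ck_comp {V W W' : normedModType R} k (U : set V) (U' : set W) (f : V -> W)
    (g : W -> W') : finite_frame W -> open U -> open U' ->
  (forall x, U x -> U' (f x)) -> Ck k U f -> Ck k U' g -> Ck k U (g \o f).
Proof.
move=> [I [e [l [lc le]]]] oU oU' UU'; elim: k f g UU' => [|k IH] f g UU'.
  move=> fc gc x Ux; apply: continuous_comp; first exact: fc.
  by apply: gc; exact: UU'.
move=> cf cg; have [df Df] := cf; have [dg Dg] := cg.
split=> [x Ux|v].
  by apply: differentiable_comp; [exact: df|apply: dg; exact: UU'].
apply: (Ck_eq (f := fun x => \sum_i l i ('D_v f x) *: 'D_(e i) g (f x))) => //.
  move=> x Ux; rewrite derive_comp; [|exact: df|by apply: dg; exact: UU'].
  rewrite [in RHS](le ('D_v f x)) derive_linear_sum //.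
  by apply: dg; exact: UU'.
apply: Ck_sum => // i; apply: CkZ => //; last first.
  by apply: (IH f (fun y => 'D_(e i) g y) UU'); [exact: Ck_pred|exact: Dg].
by apply: (Ck_linear_comp (h := fun y => 'D_v f y)) => //; exact: Df.
Qed.

End CkCalculus.

(** * Smooth maps into manifolds *)

Section Frames.
Context {R : realType}.

Lemma finite_frame_real : finite_frame (R : normedModType R).
Proof.
exists unit, (fun=> 1), (fun=> (idfun : {linear R -> R^o})); split.
  by move=> i x; exact: cvg_id.
by move=> v; rewrite (big_pred1 tt) => [|[]//]; rewrite /= /GRing.scale /= mulr1.
Qed.

Definition mx_entry m n (i : 'I_m) (j : 'I_n) (A : 'M[R]_(m, n)) : R^o := A i j.

Lemma mx_entry_is_linear m n (i : 'I_m) (j : 'I_n) : linear (mx_entry i j).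
Proof. by move=> a u v; rewrite /mx_entry !mxE. Qed.

HB.instance Definition _ m n i j :=
  GRing.isLinear.Build R 'M[R]_(m, n) R^o _ _ (mx_entry_is_linear i j).

Lemma finite_frame_rV n : finite_frame ('rV[R]_n : normedModType R).
Proof.
exists 'I_n, (fun j => delta_mx 0 j), (fun j => mx_entry 0 j); split.
  by move=> j A; exact: coord_continuous.
by move=> v; rewrite {1}(row_sum_delta v).
Qed.

Lemma finite_frame_pair (V W : normedModType R) :
  finite_frame V -> finite_frame W ->
  finite_frame ((V * W)%type : normedModType R).
Proof.
move=> [I [e [l [lc le]]]] [J [f [k [kc ke]]]].
pose l' i := (l i \o fst : {linear (V * W)%type -> R^o}).
pose k' j := (k j \o snd : {linear (V * W)%type -> R^o}).
exists (I + J)%type.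
exists (fun c => match c with inl i => (e i, 0) | inr j => (0, f j) end).
exists (fun c => match c with inl i => l' i | inr j => k' j end); split.
  case=> [i|j] p; rewrite /=.
    by apply: continuous_comp; [exact: cvg_fst|exact: lc].
  by apply: continuous_comp; [exact: cvg_snd|exact: kc].
case=> v w; rewrite big_sumType /=.
rewrite [LHS](_ : _ = (v, 0) + (0, w)); last first.
  by congr pair; rewrite ?addr0 ?add0r.
congr (_ + _).
  rewrite {1}(le v); elim/big_ind2 : _ => [//|x1 x2 y1 y2 <- <-|i _].
    by congr pair; rewrite addr0.
  by congr pair; rewrite scaler0.
rewrite {1}(ke w); elim/big_ind2 : _ => [//|x1 x2 y1 y2 <- <-|i _].
  by congr pair; rewrite addr0.
by congr pair; rewrite scaler0.
Qed.

End Frames.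

Section SmoothMaps.
Context {R : realType}.
Implicit Types V W : normedModType R.

Section Charts.
Context {n : nat} {M : manifoldType R n}.
Implicit Types x y : M.

Lemma open_cdom x : open (cdom x).
Proof. exact: chart_dom_open. Qed.

Lemma open_cimg x : open (cimg x).
Proof. exact: chart_img_open. Qed.

Lemma cdom_self x : cdom x x.
Proof. exact: chart_at_dom. Qed.

Lemma mcoordK x y : cdom x y -> muncoord x (mcoord x y) = y.
Proof. exact: chart_fwdK. Qed.

Lemma cimg_mcoord x y : cdom x y -> cimg x (mcoord x y).
Proof. by move=> xy; exists y. Qed.

Lemma cdom_muncoord x u : cimg x u -> cdom x (muncoord x u).
Proof. by case=> y xy <-; rewrite [muncoord _ _]mcoordK. Qed.

Lemma muncoordK x u : cimg x u -> mcoord x (muncoord x u) = u.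
Proof. by case=> y xy <-; rewrite [muncoord _ _]mcoordK. Qed.

End Charts.

Lemma open_setI_preimage {V} {T : topologicalType} (U : set V) (O : set T)
    (s : V -> T) : open U -> open O -> (forall u, U u -> {for u, continuous s}) ->
  open (U `&` s @^-1` O).
Proof.
move=> oU oO sc; rewrite openE => u [Uu Osu].
apply: filterI; first exact: open_nbhs_nbhs.
by apply: (sc u Uu); exact: open_nbhs_nbhs.
Qed.

Lemma open_setX {T1 T2 : topologicalType} (A : set T1) (B : set T2) :
  open A -> open B -> open (A `*` B).
Proof.
move=> oA oB; rewrite openE => -[x y] [/= Ax By].
by exists (A, B) => //; split; exact: open_nbhs_nbhs.
Qed.

Lemma Cinfty_continuous {V W} (U : set V) (f : V -> W) u :
  Cinfty U f -> U u -> {for u, continuous f}.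
Proof. by move=> /(_ 0%N); apply. Qed.

Lemma Cinfty_differentiable {V W} (U : set V) (f : V -> W) u :
  Cinfty U f -> U u -> differentiable f u.
Proof. by move=> /(_ 1%N)[+ _]; apply. Qed.

Lemma Cinfty_subset {V W} (U U' : set V) (f : V -> W) :
  U' `<=` U -> Cinfty U f -> Cinfty U' f.
Proof. by move=> UU' cf k; apply: Ck_subset UU' _. Qed.

Lemma Cinfty_comp {V W} {W' : normedModType R} (U : set V) (U' : set W)
    (f : V -> W) (g : W -> W') : finite_frame W -> open U -> open U' ->
  (forall x, U x -> U' (f x)) -> Cinfty U f -> Cinfty U' g -> Cinfty U (g \o f).
Proof. by move=> fW oU oU' UU' cf cg k; exact: (Ck_comp fW oU oU' UU'). Qed.

Lemma smooth_from_local {V n} {M : manifoldType R n} (U : set V) (s : V -> M) :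
  (forall u, U u -> exists2 U' : set V, U' u & smooth_from U' s) ->
  smooth_from U s.
Proof.
move=> H; split=> [u /H[U' U'u [+ _]]|y k]; first exact.
apply: Ck_local => u [/H[U' U'u [_ ss]] ysu].
by exists (U' `&` s @^-1` cdom y) => //; exact: ss.
Qed.

Lemma smooth_from_eq {V n} {M : manifoldType R n} (U : set V) (s s' : V -> M) :
  open U -> (forall u, U u -> s u = s' u) -> smooth_from U s -> smooth_from U s'.
Proof.
move=> oU ss' [sc ss]; split=> [u Uu|y k].
  have := sc u Uu; rewrite /prop_for /continuous_at ss' // => h.
  apply: cvg_trans h; apply: near_eq_cvg.
  by near do rewrite ss' //; exact: open_nbhs_nbhs.
have -> : U `&` s' @^-1` cdom y = U `&` s @^-1` cdom y.
  by apply/seteqP; split=> u [Uu] /=; rewrite ss'.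
apply: Ck_eq (ss y k).
  by apply: open_setI_preimage => //; exact: open_cdom.
by move=> u [/ss' ->].
Unshelve. all: by end_near. Qed.

Lemma smooth_from_cst {V n} {M : manifoldType R n} (U : set V) (x : M) :
  smooth_from U (fun=> x).
Proof. by split=> [u _|y k]; [exact: cst_continuous|exact: Ck_cst]. Qed.

Lemma smooth_from_muncoord n (M : manifoldType R n) (x : M) :
  smooth_from (cimg x) (muncoord x).
Proof.
split=> [u xu|y]; first exact: chart_inv_cont.
apply: Cinfty_subset (chart_at_compat x y) => u [xu yu].
by exists (muncoord x u); [split=> //; exact: cdom_muncoord|exact: muncoordK].
Qed.

Lemma smooth_from_comp {V W n} {M : manifoldType R n} (U : set V) (U' : set W)
    (h : V -> W) (s : W -> M) : finite_frame W -> open U -> open U' ->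
  (forall u, U u -> U' (h u)) -> Cinfty U h -> smooth_from U' s ->
  smooth_from U (s \o h).
Proof.
move=> fW oU oU' UU' ch [sc ss]; split=> [u Uu|y].
  apply: continuous_comp; first exact: Cinfty_continuous ch Uu.
  by apply: sc; exact: UU'.
have hc u : U u -> {for u, continuous h} by exact: Cinfty_continuous.
have shc u : U u -> {for u, continuous (s \o h)}.
  by move=> Uu; apply: continuous_comp; [exact: hc|apply: sc; exact: UU'].
have oy := @open_cdom n M y.
apply: (Cinfty_comp (U' := U' `&` s @^-1` cdom y) (f := h)
  (g := fun w => mcoord y (s w)) fW) => //.
- exact: open_setI_preimage.
- exact: open_setI_preimage.
- by move=> u [/UU' ? ?].
- by apply: Cinfty_subset ch => u [].
Qed.

Lemma smooth_from_mcoord {V n} {M : manifoldType R n} (U : set V) (s : V -> M)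
    y : smooth_from U s ->
  Cinfty (U `&` s @^-1` cdom y) (fun u => mcoord y (s u)).
Proof. by case=> _; exact. Qed.

(** Near a point u0 the map is the coordinate expression of F at (s u0, r u0),
    composed with the coordinates of s and r; smoothness being local, this is enough. *)
Lemma smooth_map2_from {V l m n} {N : manifoldType R l} {P : manifoldType R m}
    {M : manifoldType R n} (F : N -> P -> M) (U : set V) (s : V -> N)
    (r : V -> P) : open U -> smooth_map2 F -> smooth_from U s ->
  smooth_from U r -> smooth_from U (fun u => F (s u) (r u)).
Proof.
move=> oU sF ss sr; apply: smooth_from_local => u0 Uu0.
set x := s u0; set y := r u0.
set Us := U `&` s @^-1` cdom x; set Ur := U `&` r @^-1` cdom y.
have oUs : open Us by apply: open_setI_preimage ss.1 => //; exact: open_cdom.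
have oUr : open Ur by apply: open_setI_preimage sr.1 => //; exact: open_cdom.
exists (Us `&` Ur); first by do ![split=> //]; exact: cdom_self.
have oU' : open (Us `&` Ur) by exact: openI.
apply: (@smooth_from_eq _ _ _ _ ((fun u : 'rV[R]_l * 'rV[R]_m =>
    F (muncoord x u.1) (muncoord y u.2)) \o
    (fun u => (mcoord x (s u), mcoord y (r u))))) => //.
  by move=> u [[_ xs] [_ yr]] /=; rewrite !mcoordK.
apply: smooth_from_comp (sF x y) => //.
- by apply: finite_frame_pair; exact: finite_frame_rV.
- by apply: open_setX; exact: open_cimg.
- by move=> u [[_ xs] [_ yr]]; split; exact: cimg_mcoord.
- move=> k; apply: Ck_pair => //.
    by apply: Ck_subset (smooth_from_mcoord x ss k) => u [].
  by apply: Ck_subset (smooth_from_mcoord y sr k) => u [].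
Qed.

Lemma smooth_map_from {V m n} {P : manifoldType R m} {M : manifoldType R n}
    (F : P -> M) (U : set V) (r : V -> P) : open U -> smooth_map F ->
  smooth_from U r -> smooth_from U (fun u => F (r u)).
Proof.
move=> oU sF sr; apply: smooth_from_local => u0 Uu0.
set y := r u0; set Ur := U `&` r @^-1` cdom y.
have oUr : open Ur by apply: open_setI_preimage sr.1 => //; exact: open_cdom.
exists Ur; first by split=> //; exact: cdom_self.
apply: (@smooth_from_eq _ _ _ _ ((fun u => F (muncoord y u)) \o
    (fun u => mcoord y (r u)))) => //; first by move=> u [_ yr] /=; rewrite mcoordK.
apply: smooth_from_comp (sF y) => //.
- exact: finite_frame_rV.
- exact: open_cimg.
- by move=> u [_ yr]; exact: cimg_mcoord.
- exact: smooth_from_mcoord.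
Qed.

Lemma smooth_fun_from {V n} {M : manifoldType R n}
    (f : M -> R) (U : set V) (r : V -> M) : open U -> smooth_fun f ->
  smooth_from U r -> Cinfty U (fun u => f (r u)).
Proof.
move=> oU sf sr k; apply: Ck_local => u0 Uu0.
set y := r u0; set Ur := U `&` r @^-1` cdom y.
have oUr : open Ur by apply: open_setI_preimage sr.1 => //; exact: open_cdom.
exists Ur; first by split=> //; exact: cdom_self.
apply: (@Ck_eq _ _ _ _ _ ((fun u => f (muncoord y u)) \o
    (fun u => mcoord y (r u)))) => //; first by move=> u [_ yr] /=; rewrite mcoordK.
apply: Ck_comp (sf y k) => //.
- exact: finite_frame_rV.
- exact: open_cimg.
- by move=> u [_ yr]; exact: cimg_mcoord.
- exact: smooth_from_mcoord.
Qed.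

Lemma smooth_map2_l {l m n} {N : manifoldType R l} {P : manifoldType R m}
    {M : manifoldType R n} (F : N -> P -> M) y : smooth_map2 F ->
  smooth_map (fun x => F x y).
Proof.
move=> sF x; apply: (smooth_map2_from (r := fun=> y)) => //.
- exact: open_cimg.
- exact: smooth_from_muncoord.
- exact: smooth_from_cst.
Qed.

End SmoothMaps.

(** * Velocities and the infinitesimal action *)

Section Velocities.
Context {R : realType}.

Lemma derivable_derive1_comp {V W : normedModType R} (c : R -> V) (f : V -> W) t :
  differentiable c t -> differentiable f (c t) ->
  derive1 (f \o c) t = 'D_(derive1 c t) f (c t).
Proof. by move=> dc df; rewrite !derive1E derive_comp. Qed.

Lemma near_eq_derive1 {V : normedModType R} (c c' : R -> V) t :
  (\near t, c t = c' t) -> derive1 c t = derive1 c' t.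
Proof. by move=> cc'; rewrite !derive1E; exact: near_eq_derive. Qed.

Section OneManifold.
Context {n : nat} {M : manifoldType R n}.

Lemma smooth_from_differentiable {V : normedModType R} (U : set V) (s : V -> M) u :
  smooth_from U s -> U u -> differentiable (fun v => mcoord (s u) (s v)) u.
Proof.
move=> ss Uu; apply: (Cinfty_differentiable (smooth_from_mcoord (s u) ss)).
by split=> //; exact: cdom_self.
Qed.

Lemma velocity_comp {V : normedModType R} (U : set V) (s : V -> M) (c : R -> V) t :
  smooth_from U s -> U (c t) -> differentiable c t ->
  velocity (s \o c) t = 'D_(derive1 c t) (fun v => mcoord (s (c t)) (s v)) (c t).
Proof.
move=> ss Uct dc.
rewrite -(derivable_derive1_comp (f := fun v => mcoord (s (c t)) (s v))) //.
exact: smooth_from_differentiable ss Uct.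
Qed.

Lemma dfun_velocity (f : M -> R) (U : set R) (c : R -> M) t : open U ->
  smooth_fun f -> smooth_from U c -> U t ->
  dfun f (c t) (velocity c t) = derive1 (fun s => f (c s)) t.
Proof.
move=> oU sf sc Ut; rewrite /dfun /velocity.
have ctd := cdom_self (c t).
rewrite -(derivable_derive1_comp (c := fun s => mcoord (c t) (c s))
  (f := fun u => f (muncoord (c t) u))).
- apply: near_eq_derive1.
  have : \forall s \near t, cdom (c t) (c s).
    by apply: (sc.1 t Ut); apply: open_nbhs_nbhs; split=> //; exact: open_cdom.
  by apply: filterS => s /= ys; rewrite mcoordK.
- exact: smooth_from_differentiable sc Ut.
- by apply: Cinfty_differentiable (sf (c t)) _; exact: cimg_mcoord.
Qed.

End OneManifold.

(** The point x is separated from c t because [velocity] is written in the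
    coordinates at c t: below, c t is g t * (g t)^-1, which equals 1 without being
    convertible to it. *)
Lemma tangent_map_velocity {l n} {N : manifoldType R l} {M : manifoldType R n}
    (F : N -> M) (U : set R) (c : R -> N) t x : open U ->
  smooth_map F -> smooth_from U c -> U t -> c t = x ->
  tangent_map F x (velocity c t) = velocity (F \o c) t.
Proof.
move=> oU sF sc Ut <-; rewrite /tangent_map /velocity.
have ctd := cdom_self (c t).
rewrite -(derivable_derive1_comp (c := fun s => mcoord (c t) (c s))
  (f := fun u => mcoord (F (c t)) (F (muncoord (c t) u)))).
- apply: near_eq_derive1.
  have : \forall s \near t, cdom (c t) (c s).
    by apply: (sc.1 t Ut); apply: open_nbhs_nbhs; split=> //; exact: open_cdom.
  by apply: filterS => s /= ys; rewrite mcoordK.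
- exact: smooth_from_differentiable sc Ut.
- have := smooth_from_differentiable (sF (c t)) (cimg_mcoord ctd).
  by rewrite mcoordK.
Qed.

End Velocities.

Section Flow.
Context {R : realType} {m n : nat}.
Context {G : lieGroupType R m} {M : manifoldType R n}.

Lemma right_log_deriv_velocity (U : set R) (g : R -> G) t : open U ->
  smooth_from U g -> U t ->
  right_log_deriv g t = velocity (fun s => (g s * (g t)^-1)%g) t.
Proof.
move=> oU sg Ut; rewrite /right_log_deriv.
rewrite (@tangent_map_velocity _ _ _ _ _ (fun h : G => (h * (g t)^-1)%g) U g t) //.
exact: (smooth_map2_l (F := fun g h : G => (g * h)%g)) lie_mul_smooth.
Qed.

Lemma smooth_from_mulg (V : normedModType R) (U : set V) (s r : V -> G) :
  open U -> smooth_from U s -> smooth_from U r ->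
  smooth_from U (fun u => (s u * r u)%g).
Proof.
by move=> oU ss sr; apply: (smooth_map2_from (F := fun g h : G => (g * h)%g)) => //;
  exact: lie_mul_smooth.
Qed.

(** The Hamiltonian isotopy x |-> g t x is the flow of the time-dependent field
    generated by A_t: the curve s |-> g s * (g t)^-1 passes through 1 at time t with
    velocity A_t, and moves the point g t z along s |-> g s z. *)
Lemma gen_field_velocity (act : G -> M -> M) (U : set R) (g : R -> G) t z :
  smooth_map2 act -> (forall g h x, act (g * h)%g x = act g (act h x)) ->
  open U -> smooth_from U g -> U t ->
  gen_field act (right_log_deriv g t) (act (g t) z)
  = velocity (fun s => act (g s) z) t.
Proof.
move=> sact actM oU sg Ut; rewrite (right_log_deriv_velocity oU sg Ut).
set c := fun s => _.
have sc : smooth_from U c by apply: smooth_from_mulg => //; exact: smooth_from_cst.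
rewrite /gen_field (tangent_map_velocity oU _ sc Ut) ?[c t]mulgV //.
  by rewrite (_ : _ \o _ = fun s => act (g s) z)//; apply/funext => s /=;
    rewrite -actM /c mulgVK.
exact: smooth_map2_l.
Qed.

(** A_t is the partial derivative in the first variable, on the diagonal, of the
    smooth map (s, t) |-> g s * (g t)^-1 read in the single chart at 1. *)
Lemma right_log_deriv_continuous (U : set R) (g : R -> G) t : open U ->
  smooth_from U g -> U t -> {for t, continuous (right_log_deriv g)}.
Proof.
move=> oU sg Ut.
pose k (q : R * R) := (g q.1 * (g q.2)^-1)%g.
have oUU : open (U `*` U) by exact: open_setX.
have sfst : smooth_from (U `*` U) (fun q : R * R => g q.1).
  apply: (smooth_from_comp (h := fst : R * R -> R)) sg => //.
  - exact: finite_frame_real.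
  - by move=> q [].
  - by move=> j; apply: (@Ck_linear R (R * R)%type R^o j _ fst) => p;
      exact: cvg_fst.
have ssnd : smooth_from (U `*` U) (fun q : R * R => g q.2).
  apply: (smooth_from_comp (h := snd : R * R -> R)) sg => //.
  - exact: finite_frame_real.
  - by move=> q [].
  - by move=> j; apply: (@Ck_linear R (R * R)%type R^o j _ snd) => p;
      exact: cvg_snd.
have sk : smooth_from (U `*` U) k.
  by apply: smooth_from_mulg => //; apply: (smooth_map_from oUU _ ssnd);
    exact: lie_inv_smooth.
have /(_ 1%N)[_ Dk] := smooth_from_mcoord (1%g : G) sk.
have Dkc := Dk (1, 0).
have kE s : U s -> right_log_deriv g s =
    'D_(1, 0) (fun q => mcoord (1%g : G) (k q)) (s, s).
  move=> Us; rewrite (right_log_deriv_velocity oU sg Us) /velocity mulgV.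
  rewrite derive1E /derive.
  apply: (f_equal (fun F : R -> 'rV[R]_m => lim (F @ 0^'))); apply/funext => h /=.
  by rewrite /k /= !(scaler0, add0r) mulgV.
have ct : {for t, continuous (fun s : R => (s, s))} 
  by apply: differentiable_continuous; exact: differentiable_pair.
have kt : (U `*` U `&` k @^-1` cdom 1%g) (t, t).
  by split=> //; rewrite /k /= mulgV; exact: cdom_self.
have := continuous_comp ct (Dkc _ kt).
rewrite /prop_for /continuous_at /= -kE // => h.
apply: cvg_trans h; apply: near_eq_cvg.
have nU : \forall s \near t, U s by exact: open_nbhs_nbhs.
by apply: filterS nU => s Us; rewrite /= kE.
Qed.

End Flow.

(** * Cochains on formal chains *)

Section Chains.
Context {R : realType} {n : nat} {M : manifoldType R n}.

Lemma simplex_eq_sym k (s t : simplex M k) : simplex_eq s t -> simplex_eq t s.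
Proof. by move=> st p /st. Qed.

Lemma simplex_eq_trans k (s t u : simplex M k) :
  simplex_eq s t -> simplex_eq t u -> simplex_eq s u.
Proof. by move=> st tu p dp; rewrite st // tu. Qed.

Section Eval.
Context {k : nat} {A : pzRingType} (b : simplex M k -> A).

Lemma eval_cochain_cat (c d : chain M k) :
  eval_cochain b (c ++ d) = eval_cochain b c + eval_cochain b d.
Proof. by rewrite /eval_cochain big_cat. Qed.

Lemma eval_cochain_cons p (c : chain M k) :
  eval_cochain b (p :: c) = p.1%:~R * b p.2 + eval_cochain b c.
Proof. by rewrite /eval_cochain big_cons. Qed.

(** All terms whose simplex equals the first one contribute its coefficient times a
    common value, hence nothing; removing them leaves a shorter chain with vanishing
    coefficients. *)
Lemma eval_cochain_null (c : chain M k) : is_cochain b ->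
  (forall t, coef c t = 0) -> eval_cochain b c = 0.
Proof.
move=> cb; have [N] := ubnP (size c); elim: N c => // N IH [|p c] /= sz c0.
  by rewrite /eval_cochain big_nil.
pose eqp (q : int * simplex M k) := `[< simplex_eq q.2 p.2 >].
rewrite /eval_cochain (bigID eqp) /=.
have -> : \sum_(q <- p :: c | eqp q) q.1%:~R * b q.2 = (coef (p :: c) p.2)%:~R * b p.2.
  rewrite /coef -big_mkcond /= rmorph_sum /= mulr_suml; apply: eq_bigr => q.
  by move=> /asboolP/cb ->.
rewrite c0 mul0r add0r -big_filter; apply: IH.
  rewrite /= /eqp ifF ?(leq_ltn_trans (size_subseq (filter_subseq _ _))) //.
  by apply/negbTE; rewrite negbK; apply/asboolP => q.
move=> t; rewrite /coef big_filter.
have [/asboolP tp|/asboolP tp] := boolP `[< simplex_eq t p.2 >].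
  rewrite big1 // => q /asboolP qp; case: asboolP => // qt.
  by case: qp; exact: simplex_eq_trans qt tp.
rewrite -[RHS](c0 t) /coef big_mkcond /=; apply: eq_bigr => q _.
case: ifP => // /negbFE/asboolP qp; case: asboolP => // qt; case: tp.
exact: simplex_eq_trans (simplex_eq_sym qt) qp.
Qed.

Lemma eval_cochain_eq (c d : chain M k) : is_cochain b ->
  chain_eq c d -> eval_cochain b c = eval_cochain b d.
Proof.
move=> cb cd; apply/eqP; rewrite -subr_eq0; apply/eqP.
pose d' : chain M k := [seq (- p.1, p.2) | p <- d].
have -> : - eval_cochain b d = eval_cochain b d'.
  rewrite /eval_cochain big_map -sumrN; apply: eq_bigr => p _ /=.
  by rewrite rmorphN mulNr.
rewrite -eval_cochain_cat; apply: eval_cochain_null => // t.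
rewrite /coef big_cat /= big_map -/(coef c t) cd /coef -big_split big1 //= => p _.
by case: ifP => _; rewrite ?addr0 // subrr.
Qed.

End Eval.

Section Boundary.
Context {k : nat} {A : pzRingType} (b : simplex M k -> A).

Lemma eval_boundary_cons p (S : chain M k.+1) :
  eval_cochain b (boundary (p :: S)) =
  p.1%:~R * eval_cochain b (boundary [:: (1, p.2)])
  + eval_cochain b (boundary S).
Proof.
rewrite /boundary /= cats0 eval_cochain_cat; congr (_ + _).
rewrite /eval_cochain !big_map mulr_sumr; apply: eq_bigr => i _ /=.
by rewrite mulr1 mulrC rmorphM /= mulrA.
Qed.

End Boundary.

Lemma eval_boundary_triangle {A : pzRingType} (b : simplex M 1 -> A)
    (s : simplex M 2) : eval_cochain b (boundary [:: (1, s)]) =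
  b (face 0 s) - b (face 1 s) + b (face (inord 2) s).
Proof.
rewrite /boundary /= cats0 /eval_cochain big_map big_enum /=.
rewrite !big_ord_recl big_ord0 /= /bump /= addr0 !mulr1 expr0 expr1.
rewrite mul1r mulN1r mul1r addrA.
have -> : lift ord0 (lift ord0 ord0) = inord 2 :> 'I_3.
  by apply/val_inj; rewrite /= inordK.
by have -> : lift ord0 ord0 = 1 :> 'I_3 by exact/val_inj.
Qed.

(** Modulo integers, the symplectic area of a chain depends on its boundary only:
    this is where integrality of the class of w enters. *)
Lemma int_chain_boundary (w : two_tensor M) (c : simplex M 2 -> int)
    (b : simplex M 1 -> R) (S : chain M 2) :
  (forall s : simplex M 2, smooth_simplex s ->
     int_simplex w s = (c s)%:~R + eval_cochain b (boundary [:: (1, s)])) ->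
  smooth_chain S ->
  exists N : int, int_chain w S = N%:~R + eval_cochain b (boundary S).
Proof.
move=> q; elim: S => [_|p S IH /= [sp /IH[N SN]]].
  by exists 0; rewrite /int_chain /eval_cochain !big_nil addr0.
exists (p.1 * c p.2 + N); rewrite /int_chain eval_cochain_cons -/(int_chain w S).
rewrite SN q // eval_boundary_cons rmorphD rmorphM /= mulrDr.
by rewrite addrACA.
Qed.

End Chains.

(** * Integrals over intervals and pairings with the moment map *)

Section Integrals.
Context {R : realType}.
Let mu := @lebesgue_measure R.

Lemma continuous_itv_integrable (f : R -> R) a b :
  (forall x : R, x \in `[a, b] -> {for x, continuous f}) ->
  mu.-integrable `[a, b] (EFin \o f).
Proof.
move=> fc; apply: continuous_compact_integrable; first exact: segment_compact.
by apply: continuous_in_subspaceT => x; rewrite inE /= => /fc.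
Qed.

Lemma Rintegral_derive1 (f : R -> R) (O : set R) a b : open O ->
  Cinfty O f -> a <= b -> (forall x : R, x \in `[a, b] -> O x) ->
  \int[mu]_(x in `[a, b]) derive1 f x = f b - f a.
Proof.
move=> oO cf; rewrite le_eqVlt => /predU1P[<- _|ab abO].
  by rewrite set_itv1 Rintegral_set1 subrr.
have fc x : x \in `[a, b] -> {for x, continuous f}.
  by move=> /abO; exact: Cinfty_continuous.
have [_ /(_ 1) D1] := cf 1%N.
rewrite /Rintegral (@continuous_FTC2 _ (derive1 f) f a b ab) //.
- apply: continuous_in_subspaceT => x; rewrite inE /= => /abO /D1.
  by rewrite (_ : derive1 f = (fun y => 'D_1 f y)) //; apply/funext => y; rewrite derive1E.
- split.
  + move=> x /subset_itv_oo_cc /abO Ox; apply: diff_derivable.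
    exact: Cinfty_differentiable Ox.
  + by apply: cvg_at_right_filter; apply: fc; rewrite in_itv /= lexx ltW.
  + by apply: cvg_at_left_filter; apply: fc; rewrite in_itv /= lexx ltW.
Qed.

End Integrals.

Section Moment.
Context {R : realType} {m n : nat} {M : manifoldType R n}.

Lemma smooth_fun_continuous (f : M -> R) : smooth_fun f -> continuous f.
Proof.
move=> sf x; have xx := cdom_self x.
have fx : {for mcoord x x, continuous (fun u => f (muncoord x u))}.
  by apply: Cinfty_continuous (sf x) _; exact: cimg_mcoord.
have cx : {for x, continuous (mcoord x)} by exact: chart_fwd_cont.
have : {for x, continuous ((fun u => f (muncoord x u)) \o mcoord x)}.
  exact: continuous_comp cx fx.
rewrite /prop_for /continuous_at [X in _ --> X]/= mcoordK // => h.
apply: cvg_trans h; apply: near_eq_cvg.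
have : \forall y \near x, cdom x y.
  by apply: open_nbhs_nbhs; split => //; exact: open_cdom.
by apply: filterS => y xy; rewrite /= mcoordK.
Qed.

Lemma continuous_at_sum {T : topologicalType} {I : Type} (r : seq I)
    (F : I -> T -> R) t : (forall i, {for t, continuous (F i)}) ->
  {for t, continuous (fun s => \sum_(i <- r) F i s)}.
Proof.
move=> cF; elim: r => [|i r IH].
  rewrite (_ : (fun s => _) = cst 0); first exact: cst_continuous.
  by apply/funext => s; rewrite big_nil.
rewrite (_ : (fun s => _) = (fun s => F i s + \sum_(j <- r) F j s)).
  by apply: continuousD; [exact: cF|exact: IH].
by apply/funext => s; rewrite big_cons.
Qed.

Lemma linear_rV_sum (phi : {scalar 'rV[R]_m}) (v : 'rV[R]_m) :
  phi v = \sum_i v 0 i * phi (delta_mx 0 i).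
Proof.
rewrite {1}(row_sum_delta v) linear_sum; apply: eq_bigr => i _.
by rewrite linearZ.
Qed.

Lemma pairing_continuous (Phi : M -> {scalar 'rV[R]_m}) (c : R -> M)
    (A : R -> 'rV[R]_m) t : (forall B, smooth_fun (fun x => Phi x B)) ->
  {for t, continuous c} -> {for t, continuous A} ->
  {for t, continuous (fun s => Phi (c s) (A s))}.
Proof.
move=> sPhi cc cA.
rewrite (_ : (fun s => _) =
  (fun s => \sum_i A s 0 i * Phi (c s) (delta_mx 0 i))); last first.
  by apply/funext => s; rewrite linear_rV_sum.
apply: (@continuous_at_sum _ _ _ (fun i s => A s 0 i * Phi (c s) (delta_mx 0 i))).
move=> i; apply: continuousM.
  by apply: (continuous_comp (g := fun B : 'rV[R]_m => B 0 i) cA); exact: coord_continuous.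
apply: (continuous_comp (g := fun x => Phi x (delta_mx 0 i)) cc).
exact: smooth_fun_continuous.
Qed.

Lemma Rintegral_linear (phi : {scalar 'rV[R]_m}) (A : R -> 'rV[R]_m) :
  (forall t : R, t \in `[0, 1] -> {for t, continuous A}) ->
  \int[lebesgue_measure]_(t in `[0, 1]) phi (A t) = phi (int_vec A).
Proof.
move=> cA; rewrite [RHS]linear_rV_sum; under eq_Rintegral do rewrite linear_rV_sum.
have cAi i t : t \in `[0, 1] -> {for t, continuous (fun s => A s 0 i * phi (delta_mx 0 i))}.
  move=> /cA cAt; apply: continuousM; last exact: cst_continuous.
  by apply: (continuous_comp (g := fun B : 'rV[R]_m => B 0 i) cAt); exact: coord_continuous.
have cAi' i t : t \in `[0, 1] -> {for t, continuous (fun s => A s 0 i)}.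
  move=> /cA cAt.
  by apply: (continuous_comp (g := fun B : 'rV[R]_m => B 0 i) cAt); exact: coord_continuous.
elim: (index_enum _) => [|i r IH].
  by rewrite big_nil; under eq_Rintegral do rewrite big_nil; rewrite Rintegral_cst // mul0r.
rewrite big_cons; under eq_Rintegral do rewrite big_cons.
rewrite RintegralD //.
- rewrite IH mxE RintegralZr //; apply: continuous_itv_integrable => t; exact: cAi'.
- by apply: continuous_itv_integrable => t; exact: cAi.
- apply: continuous_itv_integrable => t t01.
  apply: (@continuous_at_sum _ _ _ (fun i s => A s 0 i * phi (delta_mx 0 i))) => j.
  exact: cAi.
Qed.

End Moment.

(** * The cylinder swept by a path under the isotopy *)

Section Cylinder.
Context {R : realType} {m n : nat} {G : lieGroupType R m} {M : manifoldType R n}.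
Context (w : two_tensor M) (act : G -> M -> M) (Phi : M -> {scalar 'rV[R]_m}).
Context (g : R -> G) (p : R -> M) (O U : set R).
Hypothesis ham : is_hamiltonian_space w act Phi.
Hypotheses (oO : open O) (oU : open U).
Hypotheses (sp : smooth_from O p) (sg : smooth_from U g).
Hypotheses (O01 : forall s : R, s \in `[0, 1] -> O s).
Hypotheses (U01 : forall t : R, t \in `[0, 1] -> U t).

Let mu := @lebesgue_measure R.
Let sigma (q : R * R) : M := act (g q.2) (p q.1).
Let K (s t : R) : R := Phi (sigma (s, t)) (right_log_deriv g t).

Let oOU : open (O `*` U).
Proof. exact: open_setX. Qed.

Let ssigma : smooth_from (O `*` U) sigma.
Proof.
apply: (smooth_map2_from oOU (ham_act_smooth ham)).
  apply: (smooth_from_comp (h := snd : R * R -> R)) sg => //.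
  - exact: finite_frame_real.
  - by move=> q [].
  - by move=> j; apply: (@Ck_linear R (R * R)%type R^o j _ snd) => q; exact: cvg_snd.
apply: (smooth_from_comp (h := fst : R * R -> R)) sp => //.
- exact: finite_frame_real.
- by move=> q [].
- by move=> j; apply: (@Ck_linear R (R * R)%type R^o j _ fst) => q; exact: cvg_fst.
Qed.

Let slice_s t : smooth_from O (fun s => sigma (s, t)).
Proof.
by apply: (smooth_map2_from (s := fun=> g t) oO (ham_act_smooth ham)) => //;
  exact: smooth_from_cst.
Qed.


(** The velocity in t is the field generated by A_t, which is Hamiltonian for
    x |-> Phi x A_t; hence its pairing with the velocity in s is minus the derivative
    of this function along the path. *)
Lemma omega_flow_velocity s t : O s -> U t ->
  w (sigma (s, t)) (velocity (fun t' => sigma (s, t')) t)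
    (velocity (fun s' => sigma (s', t)) s)
  = - derive1 (fun s' => K s' t) s.
Proof.
move=> Os Ut.
rewrite -(gen_field_velocity (p s) (ham_act_smooth ham) (ham_actM ham) oU sg Ut).
rewrite (ham_moment ham); congr (- _).
exact: (dfun_velocity oO (ham_moment_smooth ham _) (slice_s t) Os).
Qed.

Let dsigma (v : R * R) (q : R * R) : 'rV[R]_n :=
  'D_v (fun q' => mcoord (sigma q) (sigma q')) q.

Lemma velocity_line (x1 y1 x2 y2 r : R) :
  O (x1 + r * y1) -> U (x2 + r * y2) ->
  velocity (fun r' => sigma (x1 + r' * y1, x2 + r' * y2)) r
  = dsigma (y1, y2) (x1 + r * y1, x2 + r * y2).
Proof.
move=> Oq Uq; pose c r' := (x1 + r' * y1, x2 + r' * y2).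
have dc (a b x : R) : is_derive x 1 (fun r' : R => a + r' * b) b.
  have -> : (fun r' : R => a + r' * b) = cst a + b *: (id : R -> R).
    by apply/funext => y; rewrite fctE /= mulrC.
  have dZ : derivable (b *: (id : R -> R)) x 1 by apply: derivableZ.
  apply: DeriveDef; first by apply: derivableD; [exact: derivable_cst|exact: dZ].
  rewrite deriveD; [|exact: derivable_cst|exact: dZ].
  by rewrite derive_cst deriveZ // derive_id add0r; exact: mulr1.
have dc' (a b x : R) : differentiable (fun r' : R => a + r' * b) x.
  by apply/derivable1_diffP; have [] := dc a b x.
have dcr : differentiable c r.
  by have := differentiable_pair (dc' x1 y1 r) (dc' x2 y2 r).
have OUc : (O `*` U) (c r) by split.
have dcE : derive1 c r = (y1, y2).
  rewrite derive1E deriveE // (@diff_pair R R R R _ _ r (dc' x1 y1 r) (dc' x2 y2 r)).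
  have [_ e1] := dc x1 y1 r; have [_ e2] := dc x2 y2 r.
  rewrite deriveE in e1; last exact: dc'.
  rewrite deriveE in e2; last exact: dc'.
  by rewrite e1 e2.
by have := velocity_comp ssigma OUc dcr; rewrite dcE; apply.
Qed.

Lemma velocity_s s t : O s -> U t ->
  velocity (fun s' => sigma (s', t)) s = dsigma (1, 0) (s, t).
Proof.
have sE s' : 0 + s' * 1 = s' by rewrite mulr1 add0r.
have tE s' : t + s' * 0 = t by rewrite mulr0 addr0.
have /= := @velocity_line 0 1 t 0 s; rewrite sE tE => + Os Ut => <- //.
by congr (velocity _ s); apply/funext => r; rewrite sE tE.
Qed.

Lemma velocity_t s t : O s -> U t ->
  velocity (fun t' => sigma (s, t')) t = dsigma (0, 1) (s, t).
Proof.
have tE s' : 0 + s' * 1 = s' by rewrite mulr1 add0r.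
have sE s' : s + s' * 0 = s by rewrite mulr0 addr0.
have /= := @velocity_line s 0 0 1 t; rewrite sE tE => + Os Ut => <- //.
by congr (velocity _ t); apply/funext => r; rewrite sE tE.
Qed.

(** The unit square in the (s, t)-plane is cut along its antidiagonal. The vertices are
    (0, 1), (1, 0), (1, 1) for the upper half and (0, 0), (0, 1), (1, 0) for the lower
    half. In this order the last edge vector, along which the inner integral of
    [int_simplex] runs, is parallel to the s-axis, so that this integral is one of an
    s-derivative; and the boundary of upper - lower contains the two sides s = 1 and
    s = 0 with coefficients 1 and -1, the antidiagonals cancelling. *)
Definition upper_triangle : simplex M 2 :=
  fun P => sigma (P 0 1 + P 0 (inord 2), P 0 0 + P 0 (inord 2)).
Definition lower_triangle : simplex M 2 :=
  fun P => sigma (P 0 (inord 2), P 0 1).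

Lemma smooth_simplex_sigma (h : 'rV[R]_3 -> R * R) :
  Cinfty setT h -> (forall P, @std_simplex R 2 P -> (O `*` U) (h P)) ->
  smooth_simplex (fun P => sigma (h P) : M).
Proof.
move=> ch hOU; exists (setT `&` h @^-1` (O `*` U)).
have oV : open (setT `&` h @^-1` (O `*` U)).
  apply: open_setI_preimage => //; first exact: openT.
  by move=> u _; exact: Cinfty_continuous ch _.
split => //; first by move=> P /hOU.
apply: (smooth_from_comp (h := h)) ssigma => //.
- by apply: finite_frame_pair; exact: finite_frame_real.
- by move=> u [].
- exact: Cinfty_subset ch.
Qed.

Lemma Ck_entry (j : 'I_3) k : Ck k setT (fun P : 'rV[R]_3 => P 0 j).
Proof. by apply: (@Ck_linear R 'rV[R]_3 R^o k _ (mx_entry 0 j)) => P; exact: coord_continuous. Qed.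

Lemma std_simplex2 (P : 'rV[R]_3) : std_simplex P ->
  [/\ 0 <= P 0 0, 0 <= P 0 1, 0 <= P 0 (inord 2) &
      P 0 0 + P 0 1 + P 0 (inord 2) = 1].
Proof.
move=> [P0 <-]; split=> //; rewrite !big_ord_recl big_ord0 addr0 addrA.
have -> : lift ord0 (lift ord0 ord0) = inord 2 :> 'I_3.
  by apply/val_inj; rewrite /= inordK.
by have -> : lift ord0 ord0 = 1 :> 'I_3 by exact/val_inj.
Qed.

Lemma smooth_upper_triangle : smooth_simplex upper_triangle.
Proof.
apply: (smooth_simplex_sigma (h := fun P => (_, _))).
  by move=> k; apply: Ck_pair; [exact: openT|..]; apply: CkD;
    (exact: openT || exact: Ck_entry).
move=> P /std_simplex2[P0 P1 P2 P1E]; split; [apply: O01|apply: U01];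
  by rewrite in_itv /= -P1E; apply/andP; split; lra.
Qed.

Lemma smooth_lower_triangle : smooth_simplex lower_triangle.
Proof.
apply: (smooth_simplex_sigma (h := fun P => (_, _))).
  by move=> k; apply: Ck_pair; [exact: openT|exact: Ck_entry..].
move=> P /std_simplex2[P0 P1 P2 P1E]; split; [apply: O01|apply: U01];
  by rewrite in_itv /= -P1E; apply/andP; split; lra.
Qed.

Let dsigmaB s t : O s -> U t ->
  dsigma (1, -1) (s, t) = dsigma (1, 0) (s, t) - dsigma (0, 1) (s, t).
Proof.
move=> Os Ut; have OUst : (O `*` U) (s, t) by split.
have d := smooth_from_differentiable ssigma OUst.
rewrite /dsigma !deriveE // -linearB; congr ('d _ _ _).
by congr pair; rewrite ?subr0 ?sub0r.
Qed.

Let bary2_0 (a b : R) : bary2 a b 0 0 = 1 - a - b.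
Proof. by rewrite mxE. Qed.

Let bary2_1 (a b : R) : bary2 a b 0 1 = a.
Proof. by rewrite mxE. Qed.

Let bary2_2 (a b : R) : bary2 a b 0 (inord 2) = b.
Proof. by rewrite mxE inordK. Qed.

Let upper_bary2 a b : upper_triangle (bary2 a b) = sigma (a + b, 1 - a).
Proof. by rewrite /upper_triangle bary2_0 bary2_1 bary2_2 subrK. Qed.

Let lower_bary2 a b : lower_triangle (bary2 a b) = sigma (b, a).
Proof. by rewrite /lower_triangle bary2_1 bary2_2. Qed.

(** The edges are V_s - V_t and V_s, and w (V_s - V_t) V_s = - w V_t V_s because w is
    alternating. *)
Lemma upper_triangle_integrand a b : O (a + b) -> U (1 - a) ->
  w (upper_triangle (bary2 a b))
    (velocity (fun a' => upper_triangle (bary2 a' b)) a)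
    (velocity (fun b' => upper_triangle (bary2 a b')) b)
  = derive1 (fun s => K s (1 - a)) (a + b).
Proof.
move=> Oab U1a.
have sE (r : R) : b + r * 1 = r + b by rewrite mulr1 addrC.
have tE (r : R) : 1 + r * -1 = 1 - r by rewrite mulrN1.
have sE' (r : R) : a + r * 1 = a + r by rewrite mulr1.
have tE' (r : R) : (1 - a) + r * 0 = 1 - a by rewrite mulr0 addr0.
have -> : velocity (fun a' => upper_triangle (bary2 a' b)) a =
    dsigma (1, -1) (a + b, 1 - a).
  rewrite -(sE a) -(tE a) -velocity_line ?sE ?tE //.
  by congr (velocity _ a); apply/funext => r; rewrite upper_bary2 sE tE.
have -> : velocity (fun b' => upper_triangle (bary2 a b')) b =
    dsigma (1, 0) (a + b, 1 - a).
  rewrite -(sE' b) -{1}(tE' b) -velocity_line ?sE' ?tE' //.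
  by congr (velocity _ b); apply/funext => r; rewrite upper_bary2 sE' tE'.
rewrite upper_bary2 dsigmaB // -velocity_s // -velocity_t //.
have wB x v1 v2 : w x (v1 - v2) v1 = - w x v2 v1.
  have sw := ham_symplectic ham.
  by rewrite -scaleN1r addrC (symp_linear sw) (symp_alternating sw) addr0 mulN1r.
by rewrite wB omega_flow_velocity // opprK.
Qed.

Lemma lower_triangle_integrand a b : O b -> U a ->
  w (lower_triangle (bary2 a b))
    (velocity (fun a' => lower_triangle (bary2 a' b)) a)
    (velocity (fun b' => lower_triangle (bary2 a b')) b)
  = - derive1 (fun s => K s a) b.
Proof.
move=> Ob Ua; rewrite lower_bary2.
rewrite (_ : (fun a' => lower_triangle _) = (fun t' => sigma (b, t'))); last first.
  by apply/funext => r; rewrite lower_bary2.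
rewrite (_ : (fun b' => lower_triangle _) = (fun s' => sigma (s', a))); last first.
  by apply/funext => r; rewrite lower_bary2.
exact: omega_flow_velocity.
Qed.

Let CinftyK t : Cinfty O (fun s => K s t).
Proof. exact: smooth_fun_from oO (ham_moment_smooth ham _) (slice_s t). Qed.

Let continuousK (c : R -> R) t : O (c t) -> U t -> {for t, continuous c} ->
  {for t, continuous (fun t : R => K (c t) t)}.
Proof.
move=> Oct Ut cc; apply: (pairing_continuous (c := fun t => sigma (c t, t))).
- exact: ham_moment_smooth ham.
- have cid : {for t, continuous (fun t : R => t)} by exact: cvg_id.
  have cp : {for t, continuous (fun t => (c t, t))} by exact: cvg_pair cc cid.
  by apply: (continuous_comp cp); apply: ssigma.1.
- exact: right_log_deriv_continuous oU sg Ut.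
Qed.

Lemma int_upper_triangle : int_simplex w upper_triangle =
  \int[mu]_(a in `[0, 1]) (K 1 (1 - a) - K a (1 - a)).
Proof.
apply: eq_Rintegral => a; rewrite inE /= in_itv /= => /andP[a0 a1].
have U1a : U (1 - a) by apply: U01; rewrite in_itv /=; apply/andP; split; lra.
pose f b := K (a + b) (1 - a).
have caff : Cinfty setT (fun b : R => a + b).
  by move=> k; apply: CkD; [exact: openT|exact: Ck_cst|];
    apply: (@Ck_linear R R R k _ idfun) => x; exact: cvg_id.
pose O' := setT `&` (fun b => a + b) @^-1` O.
have oO' : open O'.
  apply: open_setI_preimage => //; first exact: openT.
  by move=> u _; exact: Cinfty_continuous caff _.
have cf : Cinfty O' f.
  apply: (Cinfty_comp (f := fun b => a + b) (g := fun s => K s (1 - a)) _ oO' oO).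
  - exact: finite_frame_real.
  - by move=> u [].
  - exact: Cinfty_subset caff.
  - exact: CinftyK.
transitivity (f (1 - a) - f 0); last first.
  by rewrite /f addr0 (addrC a) subrK.
rewrite -(Rintegral_derive1 oO' cf); last 2 first.
- by rewrite subr_ge0.
- move=> b; rewrite in_itv /= => /andP[b0 b1]; split => //=.
  by apply: O01; rewrite in_itv /=; apply/andP; split; lra.
apply: eq_Rintegral => b; rewrite inE /= in_itv /= => /andP[b0 b1].
have Oab : O (a + b) by apply: O01; rewrite in_itv /=; apply/andP; split; lra.
rewrite upper_triangle_integrand //.
rewrite /f -[X in _ = derive1 X b]/((fun s => K s (1 - a)) \o (fun b => a + b)).
rewrite derivable_derive1_comp; last 2 first.
- exact: (Cinfty_differentiable caff).
- exact: (Cinfty_differentiable (CinftyK (1 - a))).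
have -> : derive1 (fun b : R => a + b) b = 1.
  rewrite derive1E deriveD; [|exact: derivable_cst|exact: derivable_id].
  by rewrite derive_cst derive_id add0r.
by rewrite derive1E.
Qed.

Lemma int_lower_triangle : int_simplex w lower_triangle =
  \int[mu]_(a in `[0, 1]) - (K (1 - a) a - K 0 a).
Proof.
apply: eq_Rintegral => a; rewrite inE /= in_itv /= => /andP[a0 a1].
have Ua : U a by apply: U01; rewrite in_itv /= a0.
have sub b : b \in `[0, 1 - a] -> O b.
  rewrite in_itv /= => /andP[b0 b1]; apply: O01.
  by rewrite in_itv /=; apply/andP; split; lra.
have cNK : Cinfty O (fun s => - K s a).
  move=> k; apply: (@Ck_linear_comp R R R R k _ (-%R : {linear R -> R}) (fun s => K s a)) => //.
    exact: opp_continuous.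
  exact: CinftyK.
rewrite opprB [RHS]addrC -[K 0 a]opprK -(Rintegral_derive1 oO cNK) ?subr_ge0 //.
apply: eq_Rintegral => b; rewrite inE /= => /sub Ob.
rewrite lower_triangle_integrand // !derive1E deriveN //.
by apply: diff_derivable; exact: (Cinfty_differentiable (CinftyK a)).
Qed.

(** The flux formula: the area of the cylinder is the difference of the time integrals
    of the Hamiltonian along its two boundary curves. The contributions of the
    antidiagonal cancel after the substitution of 1 - t for t. *)
Lemma int_triangles : int_simplex w upper_triangle - int_simplex w lower_triangle
  = \int[mu]_(t in `[0, 1]) K 1 t - \int[mu]_(t in `[0, 1]) K 0 t.
Proof.
have O0 : O 0 by apply: O01; rewrite in_itv /= lexx ler01.
have O1 : O 1 by apply: O01; rewrite in_itv /= lexx ler01.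
have onem01 (t : R) : t \in `[0, 1 : R] -> 1 - t \in `[0, 1].
  by rewrite !in_itv /= => /andP[? ?]; apply/andP; split; lra.
have cK (c : R -> R) t : continuous c -> O (c t) -> t \in `[0, 1] ->
    {for t, continuous (fun t : R => K (c t) t)}.
  by move=> cc Oct /U01 Ut; apply: continuousK => //; exact: cc.
have conem : continuous (fun t : R => 1 - t).
  by move=> t; apply: continuousB; [exact: cst_continuous|exact: cvg_id].
have cK1 (t : R) : t \in `[0, 1] -> {for t, continuous (fun t : R => K 1 t)}.
  by move=> ?; apply: (cK (cst 1)) => //; exact: cst_continuous.
have cK0 (t : R) : t \in `[0, 1] -> {for t, continuous (fun t : R => K 0 t)}.
  by move=> ?; apply: (cK (cst 0)) => //; exact: cst_continuous.
have cKo (t : R) : t \in `[0, 1] -> {for t, continuous (fun t : R => K (1 - t) t)}.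
  by move=> ?; apply: (cK (fun t => 1 - t)) => //; apply: O01; exact: onem01.
have iK1 := continuous_itv_integrable cK1.
have iK0 := continuous_itv_integrable cK0.
have iKo := continuous_itv_integrable cKo.
have -> : int_simplex w upper_triangle =
    \int[mu]_(t in `[0, 1]) (K 1 t - K (1 - t) t).
  rewrite int_upper_triangle.
  rewrite [RHS]Rintegration_by_substitution_onem ?ler01 ?lexx //.
    by rewrite unstable.onem1; apply: eq_Rintegral => t _; rewrite /unstable.onem subKr.
  apply: continuous_in_subspaceT => t; rewrite inE /= => t01.
  exact: (continuousB (cK1 t t01) (cKo t t01)).
have -> : int_simplex w lower_triangle =
    \int[mu]_(t in `[0, 1]) (K 0 t - K (1 - t) t).
  by rewrite int_lower_triangle; apply: eq_Rintegral => t _; rewrite opprB.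
by rewrite !RintegralB //; lra.
Qed.

End Cylinder.

(** * Reduction modulo integers *)

Section Periodicity.
Context {R : realType}.

Definition int_congr (r r' : R) : Prop := exists N : int, r = r' + N%:~R.

Lemma int_congr_refl r : int_congr r r.
Proof. by exists 0; rewrite addr0. Qed.

Lemma int_congr_sym r r' : int_congr r r' -> int_congr r' r.
Proof. by move=> [N ->]; exists (- N); rewrite rmorphN addrK. Qed.

Lemma int_congr_trans r r' r'' :
  int_congr r r' -> int_congr r' r'' -> int_congr r r''.
Proof. by move=> [N ->] [N' ->]; exists (N' + N); rewrite rmorphD addrA. Qed.

Lemma expC_2pi_congr (r r' : R) : int_congr r r' ->
  expC (0 +i* (2 * pi * r)) = expC (0 +i* (2 * pi * r')).
Proof.
move=> [N ->]; rewrite mulrDr.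
have E : 2 * pi * N%:~R = (pi *+ 2) *~ N :> R.
  by rewrite mulr_natl mulrzr.
rewrite E {E}; set x := 2 * pi * r'.
have sc (f : R -> R) : periodic f (pi *+ 2) -> f (x + (pi *+ 2) *~ N) = f x.
  move=> pf; case: N => k; first by rewrite -pmulrn (periodicn pf).
  rewrite NegzE mulrNz -pmulrn.
  rewrite -[in RHS](subrK ((pi *+ 2) *+ k.+1) x).
  by rewrite (periodicn pf).
by rewrite /expC /= !sc //; [exact: sinD2pi|exact: cosD2pi].
Qed.

End Periodicity.

(** * Faces of triangles and constant simplices *)

Section Faces.
Context {R : realType} {n : nat} {M : manifoldType R n}.

Lemma face_lift k (i : 'I_k.+2) (P : 'rV[R]_k.+1) (l : 'I_k.+1) :
  (\row_j (if unlift i j is Some l then P 0 l else 0)) 0 (lift i l) = P 0 l.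
Proof. by rewrite mxE liftK. Qed.

Lemma face_self k (i : 'I_k.+2) (P : 'rV[R]_k.+1) :
  (\row_j (if unlift i j is Some l then P 0 l else 0)) 0 i = 0.
Proof. by rewrite mxE unlift_none. Qed.

Definition face_row (i : 'I_3) (P : 'rV[R]_2) : 'rV[R]_3 :=
  \row_j (if unlift i j is Some l then P 0 l else 0).

Let lift_01 : lift 0 0 = 1 :> 'I_3. Proof. exact/val_inj. Qed.
Let lift_02 : lift 0 1 = inord 2 :> 'I_3.
Proof. by apply/val_inj; rewrite /= inordK. Qed.
Let lift_10 : lift 1 0 = 0 :> 'I_3. Proof. exact/val_inj. Qed.
Let lift_12 : lift 1 1 = inord 2 :> 'I_3.
Proof. by apply/val_inj; rewrite /= inordK. Qed.
Let lift_20 : lift (inord 2) 0 = 0 :> 'I_3.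
Proof. by apply/val_inj; rewrite /= /bump inordK. Qed.
Let lift_21 : lift (inord 2) 1 = 1 :> 'I_3.
Proof. by apply/val_inj; rewrite /= /bump inordK. Qed.

Lemma face_row0 P : [/\ face_row 0 P 0 0 = 0, face_row 0 P 0 1 = P 0 0 &
  face_row 0 P 0 (inord 2) = P 0 1].
Proof.
rewrite -lift_01 -lift_02; split; [exact: face_self|exact: face_lift..].
Qed.

Lemma face_row1 P : [/\ face_row 1 P 0 0 = P 0 0, face_row 1 P 0 1 = 0 &
  face_row 1 P 0 (inord 2) = P 0 1].
Proof.
split; first by rewrite -[X in _ 0 X = _]lift_10; exact: face_lift.
  exact: face_self.
by rewrite -lift_12; exact: face_lift.
Qed.

Lemma face_row2 P : [/\ face_row (inord 2) P 0 0 = P 0 0,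
  face_row (inord 2) P 0 1 = P 0 1 & face_row (inord 2) P 0 (inord 2) = 0].
Proof.
split; [rewrite -[X in _ 0 X = _]lift_20; exact: face_lift
       |rewrite -[X in _ 0 X = _]lift_21; exact: face_lift|exact: face_self].
Qed.

Lemma std_simplex1 (P : 'rV[R]_2) : std_simplex P -> P 0 0 + P 0 1 = 1.
Proof.
move=> [_ <-]; rewrite !big_ord_recl big_ord0 addr0.
by have -> : lift ord0 ord0 = 1 :> 'I_2 by exact/val_inj.
Qed.

Lemma smooth_simplex_cst k (x : M) : smooth_simplex (fun _ : 'rV[R]_k.+1 => x).
Proof. by exists setT; split => //; [exact: openT|exact: smooth_from_cst]. Qed.

Lemma int_simplex_cst (w : two_tensor M) (x : M) : Defs.is_symplectic w ->
  int_simplex w (fun=> x) = 0.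
Proof.
move=> sw; transitivity (\int[@lebesgue_measure R]_(a in `[0, 1]) (0 : R)).
  apply: eq_Rintegral => a _.
  rewrite -[RHS](mul0r (fine (@lebesgue_measure R `[0, 1 - a]))) -Rintegral_cst //.
  apply: eq_Rintegral => b _; rewrite /velocity /= !derive1_cst.
  exact: (symp_alternating sw).
by rewrite Rintegral_cst // mul0r.
Qed.

End Faces.

(** * The action integral of a Hamiltonian loop *)

Section ActionOfLoop.
Context {R : realType} {m n : nat} {G : lieGroupType R m} {M : manifoldType R n}.
Context (w : two_tensor M) (act : G -> M -> M) (Phi : M -> {scalar 'rV[R]_m}).
Context (g : R -> G) (U : set R) (c : simplex M 2 -> int) (b : simplex M 1 -> R).
Hypothesis ham : is_hamiltonian_space w act Phi.
Hypotheses (oU : open U) (sg : smooth_from U g).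
Hypotheses (U01 : forall t : R, t \in `[0, 1] -> U t).
Hypotheses (g0 : g 0 = 1%g) (g1 : forall x, act (g 1) x = x).
Hypothesis cb : is_cochain b.
Hypothesis int_simplexE : forall s : simplex M 2, smooth_simplex s ->
  int_simplex w s = (c s)%:~R + eval_cochain b (boundary [:: (1, s)]).

Let A := right_log_deriv g.
Let orbit (x : M) : simplex M 1 := curve_simplex (fun t => act (g t) x).

(** The exponent of the action integral at x divided by 2 pi i, up to an integer, with the
    area of a spanning chain replaced by the value on the orbit of the real cochain b,
    whose coboundary is the period cochain of w minus an integral one. Unlike the area
    it is defined without a spanning chain. *)
Definition reduced_action (x : M) : R :=
  b (orbit x) - \int[lebesgue_measure]_(t in `[0, 1]) Phi (act (g t) x) (A t).

(** The cylinder over p has boundary orbit (p 1) - orbit (p 0): the sides t = 0 and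
    t = 1 are both the path p, because g 0 = 1 and g 1 acts trivially. So its area is,
    modulo integers, the difference of the values of b; the flux formula says that it
    is also the difference of the Hamiltonian integrals. *)
Lemma reduced_action_path (p : R -> M) (O : set R) : open O -> smooth_from O p ->
  (forall s : R, s \in `[0, 1] -> O s) ->
  int_congr (reduced_action (p 1)) (reduced_action (p 0)).
Proof.
move=> oO sp O01.
have := int_triangles ham oO oU sp sg O01 U01.
rewrite int_simplexE; last exact: smooth_upper_triangle ham oO oU sp sg O01 U01.
rewrite int_simplexE; last exact: smooth_lower_triangle ham oO oU sp sg O01 U01.
rewrite !eval_boundary_triangle.
set T1 := upper_triangle act g p; set T2 := lower_triangle act g p.
have -> : b (face 0 T1) = b (orbit (p 1)).
  apply: cb => P /std_simplex1 P1; rewrite /face -/(face_row 0 P) /T1 /upper_triangle.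
  by have [-> -> ->] := face_row0 P; rewrite /= P1 add0r.
have -> : b (face 1 T1) = b (curve_simplex p).
  apply: cb => P /std_simplex1 P1; rewrite /face -/(face_row 1 P) /T1 /upper_triangle.
  by have [-> -> ->] := face_row1 P; rewrite /= P1 add0r g1.
have -> : b (face (inord 2) T2) = b (orbit (p 0)).
  apply: cb => P /std_simplex1 P1.
  rewrite /face -/(face_row (inord 2) P) /T2 /lower_triangle.
  by have [_ -> ->] := face_row2 P.
have -> : b (face 1 T2) = b (curve_simplex p).
  apply: cb => P /std_simplex1 P1; rewrite /face -/(face_row 1 P) /T2 /lower_triangle.
  by have [_ -> ->] := face_row1 P; rewrite /= g0 (ham_act1 ham).
have -> : b (face (inord 2) T1) = b (face 0 T2).
  apply: cb => P /std_simplex1 P1.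
  rewrite /face -/(face_row (inord 2) P) -/(face_row 0 P).
  rewrite /T1 /T2 /upper_triangle /lower_triangle.
  have [-> -> ->] := face_row2 P; have [_ -> ->] := face_row0 P.
  by rewrite /= !addr0.
rewrite /reduced_action /A /= => E.
exists (c T2 - c T1); rewrite rmorphB /=; move: E; lra.
Qed.

(** Nearby points are joined by a straight segment in a chart. *)
Lemma reduced_action_locally_constant (x : M) :
  \forall y \near x, int_congr (reduced_action y) (reduced_action x).
Proof.
pose u := mcoord x x.
have xu : cimg x u by apply: cimg_mcoord; exact: cdom_self.
have /nbhs_ballP[e /= e0 xe] : nbhs u (cimg x).
  by apply: open_nbhs_nbhs; split => //; exact: open_cimg.
have nx : \forall y \near x, cdom x y.
  by apply: open_nbhs_nbhs; split; [exact: open_cdom|exact: cdom_self].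
have nball : \forall y \near x, ball u e (mcoord x y).
  have cx : {for x, continuous (mcoord x)} by apply: chart_fwd_cont; exact: cdom_self.
  by apply: cx; exact: nbhsx_ballx.
apply: filterS2 nx nball => y xy uy.
pose v := mcoord x y - u; pose h (s : R) : 'rV[R]_n := u + s *: v.
have ch : Cinfty setT h.
  move=> k; apply: CkD; [exact: openT|exact: Ck_cst|].
  apply: CkZ; [exact: openT| |exact: Ck_cst].
  by apply: (@Ck_linear R R R k _ idfun) => s; exact: cvg_id.
pose O : set R := setT `&` h @^-1` cimg x.
have oO : open O.
  apply: open_setI_preimage; [exact: openT|exact: open_cimg|].
  by move=> s _; exact: Cinfty_continuous ch _.
have sp : smooth_from O (muncoord x \o h).
  apply: (smooth_from_comp (h := h)) (smooth_from_muncoord x) => //.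
  - exact: finite_frame_rV.
  - exact: open_cimg.
  - by move=> s [].
  - exact: Cinfty_subset ch.
have O01 (s : R) : s \in `[0, 1] -> O s.
  rewrite in_itv /= => /andP[s0 s1]; split => //; apply: xe.
  move: uy; rewrite -!ball_normE /= /h opprD addNKr normrN normrZ ger0_norm //.
  rewrite distrC => uy; apply: le_lt_trans uy.
  by rewrite -[leRHS]mul1r ler_wpM2r.
have := reduced_action_path oO sp O01.
rewrite /= /h scale0r addr0 scale1r mcoordK; last exact: cdom_self.
by rewrite /v addrC subrK mcoordK.
Qed.

Lemma reduced_action_constant (x y : M) : connected [set: M] ->
  int_congr (reduced_action x) (reduced_action y).
Proof.
move=> cM; pose S := [set z | int_congr (reduced_action z) (reduced_action y)].
suff : S = setT by move=> /seteqP[_]; apply.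
have oS : open S.
  rewrite openE => z Sz; apply: filterS (reduced_action_locally_constant z) => z' Hz.
  exact: int_congr_trans Hz Sz.
have oCS : open (~` S).
  rewrite openE => z Sz; apply: filterS (reduced_action_locally_constant z) => z' Hz Sz'.
  by apply: Sz; apply: int_congr_trans (int_congr_sym Hz) Sz'.
apply: cM.
- by exists y; exact: int_congr_refl.
- by exists S => //; rewrite setTI.
- by exists S; rewrite ?setTI // -openC.
Qed.

(** The boundary of the constant triangle at x0 is the constant orbit, taken
    1 - 1 + 1 times, while its area is zero. *)
Lemma fixed_orbit_integer x0 : (forall h, act h x0 = x0) ->
  b (orbit x0) = (- c (fun=> x0))%:~R.
Proof.
move=> fx; pose s0 : simplex M 2 := fun=> x0.
have := int_simplexE (smooth_simplex_cst 2 x0).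
rewrite (int_simplex_cst _ (ham_symplectic ham)) eval_boundary_triangle.
have f0 i : b (face i s0) = b (orbit x0).
  by apply: cb => P _; rewrite /face /orbit /curve_simplex fx.
rewrite !f0 rmorphN /=; lra.
Qed.

Lemma reduced_action_fixed x0 : (forall h, act h x0 = x0) ->
  int_congr (reduced_action x0) (- Phi x0 (int_vec A)).
Proof.
move=> fx; exists (- c (fun=> x0)).
rewrite /reduced_action fixed_orbit_integer // addrC; congr (- _ + _).
rewrite -Rintegral_linear; first by apply: eq_Rintegral => t _; rewrite fx.
by move=> t /U01; exact: right_log_deriv_continuous.
Qed.

Lemma int_chain_reduced_action x (S : chain M 2) :
  bounds_curve S (fun t => act (g t) x) ->
  int_congr (int_chain w S
    - \int[lebesgue_measure]_(t in `[0, 1]) Phi (act (g t) x) (A t))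
    (reduced_action x).
Proof.
move=> [sS dS]; have [N ->] := int_chain_boundary int_simplexE sS.
exists N; rewrite (eval_cochain_eq cb dS) /reduced_action /eval_cochain.
by rewrite big_seq1 /= mul1r -/(orbit x); lra.
Qed.

(** The constant triangle spans the constant orbit, so [kappa] is a genuine value of
    the action integral and not the default of [xget]. *)
Lemma action_values_nonempty x0 : (forall h, act h x0 = x0) ->
  action_values w (fun t x => act (g t) x) (fun t x => Phi x (A t)) !=set0.
Proof.
move=> fx; pose S : chain M 2 := [:: (1, fun=> x0)].
eexists; exists x0, S; split; last by [].
split; first by split => //; exact: smooth_simplex_cst.
move=> t; rewrite /boundary /= cats0 /coef big_map big_enum /= big_seq1 /=.
have e : simplex_eq (curve_simplex (fun t => act (g t) x0)) (fun=> x0).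
  by move=> P _; rewrite /curve_simplex fx.
have -> : `[< simplex_eq (curve_simplex (fun t => act (g t) x0)) t >]
    = `[< simplex_eq (fun=> x0 : M) t >].
  apply/asbool_equiv_eq; split; apply: simplex_eq_trans => //.
  exact: simplex_eq_sym.
rewrite !big_ord_recl big_ord0 /face /=.
by case: ifP.
Qed.

End ActionOfLoop.

Theorem theorem10 (R : realType) (m n : nat)
    (G : lieGroupType R m) (M : manifoldType R n)
    (w : two_tensor M) (act : G -> M -> M) (Phi : M -> {scalar 'rV[R]_m})
    (g : R -> G) (x0 : M) :
  compact [set: G] -> connected [set: G] ->
  compact [set: M] -> connected [set: M] ->
  is_hamiltonian_space w act Phi ->
  quantizable w ->
  smooth_curve g -> g 0 = 1%g ->
  (forall h : G, act h x0 = x0) ->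
  (forall x : M, act (g 1) x = x) ->
  kappa w (fun t x => act (g t) x) (fun t x => Phi x (right_log_deriv g t))
  = expC (0 +i* (- (2 * pi * Phi x0 (int_vec (right_log_deriv g))))%R).
Proof.
move=> _ _ _ cM ham [c [b [_ cb _ bE]]] [U [oU U01 sg]] g0 fx g1.
have U01' (t : R) : t \in `[0, 1] -> U t by exact: U01.
have := @action_values_nonempty R m n G M w act Phi g x0 fx; rewrite /kappa => -[k kS].
have := xgetPex 0 (ex_intro _ k kS); move=> [x [S [dS ->]]].
have E1 := int_chain_reduced_action Phi cb bE dS.
have E2 := reduced_action_constant ham oU sg U01' g0 g1 cb bE x x0 cM.
have E3 := reduced_action_fixed ham oU sg U01' cb bE fx.
have E := int_congr_trans E1 (int_congr_trans E2 E3).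
by rewrite -mulrBr (expC_2pi_congr E) mulrN.
Qed.
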